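(* Let $P_3(n)$ be the number of payphone permutations of type (P3) and size $n$. Then $P_3(1) = 1$, $P_3(2) = 2$, $P_3(3) = 4$, and for any integer $n\geq 4$, $$P_3(n) = 2G(S'(n-1)) + 2G(S'(n-2)) + \sum_{i=3}^{n-2} G\big(S'(i-1)\cup S'(n-i)\big).$$
   Context: Multisets: $\#_k M$ denotes the multiplicity of $k$ in the multiset $M$, and $\cup$ denotes union of multisets with multiplicities added. For $n\ge 0$, the finite multiset $S(n)$ of positive integers is defined recursively by $S(0)=\emptyset$ and $$S(n)=\{n\}\cup S\left(\left\lfloor\tfrac{n-1}{2}\right\rfloor\right)\cup S\left(\left\lceil\tfrac{n-1}{2}\right\rceil\right)\quad (n\ge 1).$$ Further, $S'(0):=\emptyset$ and $S'(\ell):=S(\ell-1)\cup\{2\ell-1\}$ for $\ell\ge 1$. The function $G$ is defined on the finite multisets $M$ of positive integers by $$G(M) := \bigg(\prod_{k\geq 1} (\#_{2k} M + \#_{2k-1} M)!\bigg) \cdot 2^{\sum_{k\geq 2} \#_{2k} M}.$$ An empty sum equals $0$. Type (P3) payphone permutations: $n$ payphones, labeled $1,\dots,n$, are arranged in a row; the distance between payphones $i$ and $j$ is $|i-j|$. Persons $1,2,\dots,n$ come one after another and each occupies an available payphone. The first person takes any payphone. Rule (P1) is: a person takes any available payphone such that its closest occupied payphone is as distant as possible. Each person after the first obeys rule (P3): the person follows rule (P1), except that among the available payphones adjacent to an occupied one the most preferred are those located at the open ends of the row, i.e. payphones $1$ and $n$ (when available). That is, if some available payphone is at distance at least $2$ from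 all occupied payphones, the person follows (P1); if every available payphone is adjacent to an occupied one, the person takes any available payphone among payphones $1$ and $n$ if there is one, and otherwise takes any available payphone. The resulting assignment of people to payphones, $(p_1,\dots,p_n)$ with $p_j$ the person occupying payphone $j$, is a payphone permutation of type (P3) and size $n$; $P_3(n)$ counts the distinct permutations of $\{1,\dots,n\}$ that can arise this way. *)

(* Defs.v *)
From mathcomp Require Import all_boot all_fingroup.
From mathcomp Require Import ssrint.
From mathcomp Require Import finmap multiset.

Set Implicit Arguments.
Unset Strict Implicit.
Unset Printing Implicit Defensive.

Import IntDist.
Local Open Scope nat_scope.
Local Open Scope mset_scope.

(* [fuel] only makes the recursion structural; [multS0] and [multSE] below are
   the intended defining equations of the multiset S(n). *)
Fixpoint multS_rec (fuel n : nat) : {mset nat} :=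
  match fuel, n with
  | f.+1, m.+1 => [mset m.+1] `+` multS_rec f m./2 `+` multS_rec f (uphalf m)
  | _, _ => mset0
  end.

Definition multS (n : nat) : {mset nat} := multS_rec n n.

Lemma multS_rec_fuel f n : n <= f -> multS_rec f n = multS n.
Proof.
have aux : forall N g h m, m <= g -> m <= h -> m <= N ->
    multS_rec g m = multS_rec h m.
  elim=> [|N IH] [|g] [|h] [|m] //=; rewrite !ltnS => mg mh mN.
  have half_m : m./2 <= m by rewrite leq_half_double -addnn leqW // leq_addr.
  have uphalf_m : uphalf m <= m by rewrite leq_uphalf_double -addnn leq_addr.
  by congr (_ `+` _ `+` _); apply: IH;
     [exact: leq_trans mg | exact: leq_trans mh | exact: leq_trans mN
     |exact: leq_trans mg | exact: leq_trans mh | exact: leq_trans mN].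
by move=> nf; exact: (aux n).
Qed.

Lemma multS0 : multS 0 = mset0.
Proof. by []. Qed.

(* (n - 1)./2 is the floor and uphalf (n - 1) the ceiling of (n - 1) / 2. *)
Lemma multSE n : 1 <= n ->
  multS n = [mset n] `+` multS (n - 1)./2 `+` multS (uphalf (n - 1)).
Proof.
case: n => // m _; rewrite subn1 /= {1}/multS /=; congr (_ `+` _ `+` _);
  apply: multS_rec_fuel.
- by rewrite leq_half_double -addnn leqW // leq_addr.
- by rewrite leq_uphalf_double -addnn leq_addr.
Qed.

Definition multS' (l : nat) : {mset nat} :=
  if l is 0 then mset0 else multS (l - 1) `+` [mset (2 * l - 1)].

(* For k beyond the largest element of M the factor is 0! = 1 and the term of
   the exponent is 0, so that bounding k by it loses nothing ([G_bound]). *)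
Definition G (M : {mset nat}) : nat :=
  let m := \max_(x <- M) x in
  (\prod_(1 <= k < m.+1) (M (2 * k) + M (2 * k - 1))`!) *
  2 ^ (\sum_(2 <= k < m.+1) M (2 * k)).

Lemma G_bound (M : {mset nat}) (b : nat) : \max_(x <- M) x <= b ->
  G M = (\prod_(1 <= k < b.+1) (M (2 * k) + M (2 * k - 1))`!) *
        2 ^ (\sum_(2 <= k < b.+1) M (2 * k)).
Proof.
rewrite /G; set m := \max_(x <- M) x => mb.
have M0 x : m < x -> M x = 0.
  move=> mx; apply/eqP; rewrite mset_eq0; apply: contraTN mx => xM.
  by rewrite -leqNgt /m; apply: (@leq_bigmax_seq _ (M : seq nat) predT id).
have M2 k : m < k -> M (2 * k) = 0.
  by move=> mk; apply: M0; rewrite (leq_trans mk) // leq_pmull.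
congr (_ * 2 ^ _).
  rewrite (big_nat_widen _ _ b.+1) // [in RHS](bigID (fun k => k < m.+1)) /=.
  rewrite [X in _ = _ * X]big_nat_cond [X in _ = _ * X]big1 ?muln1 //.
  move=> k /andP[_]; rewrite -leqNgt => mk; rewrite M2 // M0 //.
  by rewrite mul2n -addnn -addnBA ?(leq_trans _ mk) // ltn_addr.
rewrite (big_nat_widen _ _ b.+1) // [in RHS](bigID (fun k => k < m.+1)) /=.
rewrite [X in _ = _ + X]big1 ?addn0 // => k; rewrite -leqNgt => mk.
by rewrite M2.
Qed.

Section Payphones.

Variable n : nat.

(* Payphone j is the ordinal of value j - 1; O is the set of occupied ones. *)
Implicit Types (O : {set 'I_n}) (j : 'I_n).

Definition available O j : bool := j \notin O.

(* Distance from j to the closest payphone of O, for nonempty O; the neutral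
   element n exceeds every distance in the row. *)
Definition closest_dist O j : nat := \big[minn/n]_(i in O) `|i - j|%N.

Definition P1_choice O j : bool :=
  available O j &&
  [forall i, available O i ==> (closest_dist O i <= closest_dist O j)].

Definition open_end j : bool := (j == 0 :> nat) || (j == n - 1 :> nat).

Definition P3_choice O j : bool :=
  if [exists i, available O i && [forall o in O, 2 <= `|i - o|%N]]
  then P1_choice O j
  else if [exists i, available O i && open_end i]
  then available O j && open_end j
  else available O j.

Definition allowed_choice O j : bool :=
  if O == set0 then true else P3_choice O j.

(* p j is the person occupying payphone j (again shifted by one), so that when
   that person comes the occupied payphones are the i with p i < p j. *)
Definition is_P3_perm (p : 'S_n) : bool :=
  [forall j, allowed_choice [set i | (p i < p j)%N] j].

End Payphones.

Definition P3 (n : nat) : nat := #|[set p : 'S_n | is_P3_perm p]|.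

(* Main.v *)
Require Import Defs.
From mathcomp Require Import all_boot all_fingroup ssrint.
From mathcomp Require Import finmap multiset zify ring.

(* A gap of size g between two occupied payphones contributes the multiset S(g)
   of the sizes of all gaps that will be split inside it, whatever central
   position is chosen each time; an open end of length l behaves like a gap of
   size 2l - 1 and contributes S'(l). The distance offered by a gap of size 2k - 1
   or 2k is k, so people exhaust the class {2k - 1, 2k} for the largest k before
   going on, in any order, with two positions for each gap of size 2k >= 4. Hence
   the number of completions from a nonempty occupied set is G of the union of
   the multisets of its gaps: removing from it the gap just chosen and summing
   over the admissible choices gives G back. Rule (P3) forces an open end of
   length 1 to be taken first among the payphones at distance 1, so that it can be
   ignored in the count; summing over the first person's payphone gives the
   formula. *)

Set Implicit Arguments.
Unset Strict Implicit.
Unset Printing Implicit Defensive.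

Import IntDist.
Local Open Scope nat_scope.
Local Open Scope mset_scope.

(** * Counting permutations by successive choices *)

(* Downward induction on t: once the positions of persons 0, ..., t - 1 are those
   of p0, the admissible permutations are counted by W of the occupied set. *)
Lemma card_greedy_perms n (ch : {set 'I_n} -> pred 'I_n) (W : {set 'I_n} -> nat) :
  W setT = 1 ->
  (forall O, O != setT -> W O = \sum_(j | (j \notin O) && ch O j) W (j |: O)) ->
  #|[set p : 'S_n | [forall j, ch [set i | (p i < p j)%N] j]]| = W set0.
Proof.
move=> WT WS.
pose below (p : 'S_n) t := [set i | (p i < t)%N].
pose E (p0 : 'S_n) t := [set p : 'S_n |
  [forall j, if (p0 j < t)%N then p j == p0 j else ch (below p (p j)) j]].
have EW m : forall (p0 : 'S_n) t, m + t = n -> #|E p0 t| = W (below p0 t).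
  elim: m => [|m IH] p0 t mt.
    have tE : t = n by lia.
    have -> : below p0 t = setT.
      by apply/setP=> i; rewrite !inE tE ltn_ord.
    rewrite WT -(cards1 p0); apply: eq_card => p; rewrite !inE.
    apply/forallP/eqP => [h|-> j]; last by rewrite tE ltn_ord eqxx.
    by apply/permP=> j; move: (h j); rewrite tE ltn_ord => /eqP.
  have tn : (t < n)%N by lia.
  pose tt := Ordinal tn.
  (* If [p i < t], the payphone where [p0] seats person [p i] also gets that person under [p]; by
     injectivity it is [i]. *)
  have agree p : p \in E p0 t -> forall i, (p i < t)%N = (p0 i < t)%N.
    rewrite inE => /forallP h i; apply/idP/idP => [pt|p0t]; last first.
      by move: (h i); rewrite p0t => /eqP ->.
    move: (h ((p0^-1)%g (p i))); rewrite permKV pt => /eqP /perm_inj e.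
    by rewrite -e permKV.
  rewrite WS; last first.
    apply/eqP=> /setP /(_ ((p0^-1)%g tt)); rewrite !inE permKV /=; lia.
  rewrite -sum1_card (partition_big (fun p : 'S_n => (p^-1)%g tt) xpredT) //=.
  rewrite [in RHS]big_mkcond /=; apply: eq_bigr => j _.
  rewrite sum1_card.
  have pj (p : 'S_n) : ((p^-1)%g tt == j) = (p j == tt).
    by apply/eqP/eqP => [<-|<-]; rewrite ?permKV ?permK.
  have bE p : p \in E p0 t -> p j = tt -> below p (p j) = below p0 t.
    by move=> pE e; apply/setP=> i; rewrite !inE e /= agree.
  case: ifP => [/andP[jO chj]|]; last first.
    move=> nch; apply: eq_card0 => p; rewrite unfold_in /= pj.
    apply/negP => /andP[pE /eqP e]; move/negP: nch; apply.
    have p0j : ~~ (p0 j < t)%N by rewrite -(agree p) // e /= ltnn.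
    rewrite inE p0j /= -(bE p) //.
    by move: pE; rewrite inE => /forallP /(_ j); rewrite (negPf p0j).
  (* [p1] is [p0] with person [t] swapped into [j], so that the permutations of [E p0 t] seating
     person [t] at [j] form [E p1 t.+1]. *)
  pose p1 := (p0 * tperm (p0 j) tt)%g.
  have p0j : ~~ (p0 j < t)%N by move: jO; rewrite inE.
  have p1lt x : (p0 x < t)%N -> p1 x = p0 x.
    move=> xt; rewrite permM tpermD //; last by apply: contraTneq xt => <-; rewrite /= ltnn.
    by apply: contraTneq xt => <-.
  have p1j : p1 j = tt by rewrite permM tpermL.
  have p1S x : (p1 x < t.+1)%N = (x == j) || (p0 x < t)%N.
    have [->|xj] := eqVneq x j; first by rewrite p1j /= ltnSn.
    have -> : (p1 x < t.+1)%N = (p1 x < t)%N.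
      rewrite ltnS leq_eqVlt; case: eqP => // e; case/eqP: xj.
      by apply: (@perm_inj _ p1); apply: val_inj; rewrite p1j.
    apply/idP/idP => [|h]; last by rewrite p1lt.
    rewrite permM; case: tpermP => [/perm_inj/eqP|_|//]; first by rewrite (negPf xj).
    by move=> h; move: p0j; rewrite h.
  have -> : j |: below p0 t = below p1 t.+1.
    by apply/setP=> x; rewrite !inE p1S.
  rewrite -IH; last by lia.
  apply: eq_card => p; rewrite unfold_in /= pj; apply/andP/idP => [[pE /eqP e]|].
    move: (pE); rewrite !inE => /forallP h; apply/forallP => x; rewrite p1S.
    have [->|xj] /= := eqVneq x j; first by rewrite p1j e.
    by case: ifP (h x) => // xt; rewrite p1lt.
  rewrite inE => /forallP h.
  have e : p j = tt by move: (h j); rewrite p1S eqxx p1j => /eqP.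
  split; last by rewrite e.
  have h1 x : (p0 x < t)%N -> p x = p0 x.
    by move=> xt; move: (h x); rewrite p1S xt orbT p1lt // => /eqP.
  rewrite inE; apply/forallP => x; case: ifP => xt; first by rewrite h1.
  have [->|xj] := eqVneq x j; last first.
    by move: (h x); rewrite p1S xt (negPf xj).
  suff -> : below p (p j) = below p0 t by [].
  apply/setP=> i; rewrite !inE e /=; apply/idP/idP => [pt|p0t]; last by rewrite h1.
  have := h1 ((p0^-1)%g (p i)); rewrite permKV => /(_ pt) /perm_inj ee.
  by rewrite -ee permKV.
have -> : set0 = below 1%g 0 by apply/setP=> i; rewrite !inE.
by rewrite -(EW n) ?addn0.
Qed.

(** * Multiplicities in S and S', and the function G *)

Lemma multS_split (n x : nat) : 0 < n ->
  multS n x = (x == n) + multS (n - 1)./2 x + multS (uphalf (n - 1)) x.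
Proof. by move=> n0; rewrite {1}multSE // !msetE2 msetnE; case: eqP. Qed.

Lemma multS_gt (n x : nat) : n < x -> multS n x = 0.
Proof.
elim/ltn_ind: n => -[|n] IH nx; first by rewrite multS0 mset0E.
by rewrite multS_split // !IH; lia.
Qed.

Lemma multS'E (l x : nat) : 0 < l -> multS' l x = multS (l - 1) x + (x == 2 * l - 1).
Proof. by case: l => // l _; rewrite /multS' !msetE2 msetnE; case: eqP. Qed.

Lemma multS'_gt (l x : nat) : 2 * l - 1 < x -> multS' l x = 0.
Proof.
case: l => [|l] lx; first by rewrite mset0E.
by rewrite multS'E // multS_gt; lia.
Qed.

(* G as a function of the multiplicities, with the range of k cut off at B. *)
Definition Gfun (B : nat) (f : nat -> nat) : nat :=
  (\prod_(1 <= k < B.+1) (f (2 * k) + f (2 * k - 1))`!) *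
  2 ^ (\sum_(2 <= k < B.+1) f (2 * k)).

Lemma GfunE B (M : {mset nat}) : (forall x, B < x -> M x = 0) -> G M = Gfun B M.
Proof.
move=> MB; apply: G_bound; apply/bigmax_leqP_seq => x xM _.
by rewrite leqNgt; apply: contraL xM => /MB /eqP; rewrite mset_eq0.
Qed.

Lemma eq_Gfun B f g : f =1 g -> Gfun B f = Gfun B g.
Proof.
move=> fg; rewrite /Gfun; congr (_ * 2 ^ _); apply: eq_bigr => k _; by rewrite !fg.
Qed.

(** A gap of size 2 gets 1 although both its payphones may be taken: S(2) = {2, 1} already accounts
    for that choice in the factorial of the class {1, 2}. *)
Definition ways g := if ~~ odd g && (4 <= g) then 2 else 1.

Lemma Gfun_gt0 B f : 0 < Gfun B f.
Proof. by rewrite muln_gt0 expn_gt0 prodn_gt0 // => k; rewrite fact_gt0. Qed.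

Lemma Gfun0 B : Gfun B (fun=> 0) = 1.
Proof. by rewrite /Gfun !big1. Qed.

(* The identity behind the recurrence: removing one element g of the class
   {2k - 1, 2k} divides G by the size of the class times the number of positions
   attached to g. *)
Lemma Gfun_step B (f f' : nat -> nat) (g k : nat) :
  0 < k <= B -> (g == 2 * k) || (g == 2 * k - 1) ->
  (forall x, f x = (x == g) + f' x) ->
  Gfun B f = (f (2 * k) + f (2 * k - 1)) * ways g * Gfun B f'.
Proof.
move=> /andP[k0 kB] gk fE.
have kin : k \in index_iota 1 B.+1 by rewrite mem_index_iota k0 ltnS.
rewrite /Gfun (bigD1_seq k) ?iota_uniq //= [in RHS](bigD1_seq k) ?iota_uniq //=.
have -> : \prod_(1 <= i < B.+1 | i != k) (f (2 * i) + f (2 * i - 1))`! =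
          \prod_(1 <= i < B.+1 | i != k) (f' (2 * i) + f' (2 * i - 1))`!.
  rewrite big_nat_cond [in RHS]big_nat_cond.
  apply: eq_bigr => i /andP[/andP[i0 _] ik]; rewrite !fE.
  have -> : (2 * i == g) = false by lia.
  by have -> : (2 * i - 1 == g) = false by lia.
have -> : 2 ^ (\sum_(2 <= i < B.+1) f (2 * i)) =
          ways g * 2 ^ (\sum_(2 <= i < B.+1) f' (2 * i)).
  (* The exponent drops by one exactly when [ways g] is 2. *)
  have [gE|gE] := boolP (~~ odd g && (4 <= g)); rewrite /ways; last first.
    rewrite (negPf gE) mul1n; congr (2 ^ _).
    rewrite big_nat [in RHS]big_nat; apply: eq_bigr => i i2.
    by rewrite fE (_ : (2 * i == g) = false) //; lia.
  rewrite gE -expnS; congr (2 ^ _).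
  have k2in : k \in index_iota 2 B.+1 by rewrite mem_index_iota; lia.
  rewrite (bigD1_seq k) ?iota_uniq //= [in RHS](bigD1_seq k) ?iota_uniq //=.
  rewrite fE (_ : (2 * k == g) = true) ?add1n ?addSn; last by lia.
  congr (_.+1 + _)%N; apply: eq_bigr => i ik.
  by rewrite fE (_ : (2 * i == g) = false) //; lia.
have -> : f (2 * k) + f (2 * k - 1) = (f' (2 * k) + f' (2 * k - 1)).+1.
  by rewrite !fE; lia.
by rewrite factS; ring.
Qed.

(** * Choosing a payphone in a single gap *)

(* The two positions at the centre of a gap of even size 2k >= 4 lead to the same
   multiset; weighting such a position by 1 and any other by 2 keeps the count
   integral. *)
Definition weight g := if ~~ odd g && (4 <= g) then 1 else 2.

Lemma weight_ways g : weight g * ways g = 2.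
Proof. by rewrite /weight /ways; case: ifP. Qed.

Section GapMultisets.
Variable n : nat.

(* An open end of length 1 is taken before any other payphone at distance 1, so
   it contributes nothing. *)
Definition open_gapS (l x : nat) := if l == 1 then 0 else multS' l x.

(* Payphones are numbered 1, ..., n here and a gap is given by the positions a < b
   around it; a = 0 or b = n + 1 stands for an open end of the row. *)
Definition gapS (a b x : nat) :=
  if a == 0 then open_gapS (b - 1) x
  else if b == n.+1 then open_gapS (n - a) x else multS (b - a - 1) x.

(* The element by which S or S' of the gap exceeds the multisets of the two gaps
   left after its centre (or its open end) is taken. *)
Definition gsize a b :=
  if a == 0 then 2 * (b - 1) - 1
  else if b == n.+1 then 2 * (n - a) - 1 else b - a - 1.

(* At an open end the missing neighbour is replaced by n, beyond every distance. *)
Definition gap_dist a b j :=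
  minn (if a == 0 then n else j - a) (if b == n.+1 then n else b - j).

(** In an open end the farthest payphone is the end of the row, which leaves a closed gap and
    matches the definition of S'; in a closed gap it is one of the centres, which leaves the floor
    and ceiling halves of the recursion for S. Open ends of length 1 are excluded because [gapS]
    vanishes on them while [gsize] is 1. *)
Lemma gapS_split (a b j k x : nat) : a < j < b -> b <= n.+1 -> ~~ ((a == 0) && (b == n.+1)) ->
  (a == 0) && (b == 2) = false -> (a == n - 1) && (b == n.+1) = false ->
  gap_dist a b j = k ->
  (forall i, a < i < b -> gap_dist a b i <= k) ->
  gapS a b x = (x == gsize a b) + (gapS a j x + gapS j b x).
Proof.
move=> /andP[aj jb] bn ab sl sr jk mx.
case: (posnP a) => [a0|a0].
  subst a.
  have bn1 : (b == n.+1) = false by apply: negbTE; move: ab; rewrite eqxx.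
  have j1 : j = 1.
    have := mx 1; rewrite -jk /gap_dist bn1 /=; lia.
  subst j; rewrite /gapS /gsize eqxx /= bn1 /open_gapS /=.
  rewrite (_ : (b - 1 == 1) = false) ?multS'E; try lia.
  by rewrite mset0E add0n addnC.
have a0F : (a == 0) = false by lia.
have j0F : (j == 0) = false by lia.
have [bn1|bn1] := eqVneq b n.+1.
  have jn : j = n.
    have := mx n; rewrite -jk /gap_dist a0F bn1 eqxx; lia.
  subst j b; rewrite /gapS /gsize a0F eqxx j0F /open_gapS.
  have -> : (n == n.+1) = false by lia.
  have -> : (n - a == 1) = false by lia.
  rewrite multS'E; last by lia.
  by rewrite subnn /= mset0E addn0 addnC.
have jn : (j == n.+1) = false by lia.
rewrite /gapS /gsize a0F (negbTE bn1) j0F jn multS_split; last by lia.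
have dE i : gap_dist a b i = minn (i - a) (b - i) by rewrite /gap_dist a0F (negbTE bn1).
have mid : minn (a + (b - a)./2 - a) (b - (a + (b - a)./2)) <= minn (j - a) (b - j).
  by rewrite -!dE jk mx //; lia.
have {mid} : j = a + (b - a)./2 \/ j = a + uphalf (b - a).
  move: mid; rewrite leq_min; lia.
set h1 := ((b - a - 1) - 1)./2; set h2 := uphalf (b - a - 1 - 1).
rewrite uphalfE => jE; clear mx dE jk sl sr ab a0F j0F jn; case: jE => jE.
- have -> : j - a - 1 = h1 by rewrite /h1; lia.
  have -> : b - j - 1 = h2 by rewrite /h2 uphalfE; lia.
  by rewrite addnA.
- have -> : j - a - 1 = h2 by rewrite /h2 uphalfE; lia.
  have -> : b - j - 1 = h1 by rewrite /h1; lia.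
  by rewrite -addnA; congr (_ + _); rewrite addnC.
Qed.

End GapMultisets.

(** An open end of length l offers distance l and has [gsize] 2l - 1; a closed gap of size 2k - 1 or
    2k offers k at its centre. *)
Lemma gsize_class n a b j k : a < j < b -> b <= n.+1 -> ~~ ((a == 0) && (b == n.+1)) ->
  gap_dist n a b j = k -> (forall i, a < i < b -> gap_dist n a b i <= k) ->
  (gsize n a b == 2 * k) || (gsize n a b == 2 * k - 1).
Proof.
move=> jab bn ab jk mx; rewrite /gsize.
have [a0|a0] := posnP a.
  subst a; have bn1 : (b == n.+1) = false by apply: negbTE; move: ab; rewrite eqxx.
  by have := mx 1; rewrite -jk /gap_dist bn1 /=; lia.
have a0F : (a == 0) = false by lia.
have [bn1|bn1] := eqVneq b n.+1.
  by have := mx n; rewrite -jk /gap_dist a0F bn1 eqxx; lia.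
have := mx (a + (b - a)./2); rewrite -jk /gap_dist a0F (negbTE bn1) => mid.
have : minn (a + (b - a)./2 - a) (b - (a + (b - a)./2)) <= minn (j - a) (b - j).
  by apply: mid; lia.
move: jab; clear; lia.
Qed.

(** A gap offering less than [k] gives 0 on both sides. Otherwise its own size is in the class, and
    one position of weight 2 or two of weight 1 give 2, except for a closed gap of size 2. *)
Lemma gap_choices n a b k : a < b -> b <= n.+1 -> ~~ ((a == 0) && (b == n.+1)) ->
  0 < k ->
  (forall j, a < j < b -> gap_dist n a b j <= k) ->
  ((k == 1) ==> ~~ ((a == 0) && (b == 2)) && ~~ ((a == n - 1) && (b == n.+1))) ->
  \sum_(j < n | (a < j.+1 < b) && (gap_dist n a b j.+1 == k)) weight (gsize n a b) =
  2 * (gapS n a b (2 * k) + gapS n a b (2 * k - 1)).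
Proof.
move=> ab bn nab k0 mx nsp.
have open_gapS0 l x : 2 * l - 1 < x -> open_gapS l x = 0.
  by rewrite /open_gapS; case: eqP => // _ h; rewrite multS'_gt.
have open_gapSk : k <> 1 -> open_gapS k (2 * k) + open_gapS k (2 * k - 1) = 1.
  move=> k1; rewrite /open_gapS; case: eqP => // _.
  rewrite !multS'E // !multS_gt ?eqxx; try lia.
have wodd : weight (2 * k - 1) = 2.
  by rewrite /weight ifF //; lia.
have [a0|a0] := posnP a.
  subst a; have bn1 : (b == n.+1) = false by apply: negbTE; rewrite eqxx in nab.
  rewrite /gapS /gsize /= /gap_dist bn1 /=.
  have [bk|bk] := ltnP (b - 1) k.
    rewrite big_pred0 => [|j]; last by lia.
    by rewrite !open_gapS0; lia.
  have bE : b = k.+1.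
    have [b2|b2] := leqP b 1; first by lia.
    by have := mx 1; rewrite /gap_dist bn1 /=; lia.
  have n0 : 0 < n by lia.
  rewrite (eq_bigl (mem (pred1 (Ordinal n0)))) => [|j]; last first.
    by rewrite !inE -val_eqE /=; have := ltn_ord j; lia.
  have bE1 : b - 1 = k by lia.
  rewrite sum_nat_const card1 bE1 open_gapSk ?wodd //.
  by move: nsp; rewrite bE; lia.
have a0F : (a == 0) = false by lia.
have [bn1|bn1] := eqVneq b n.+1.
  subst b; rewrite /gapS /gsize a0F eqxx /gap_dist a0F eqxx /=.
  have [ak|ak] := ltnP (n - a) k.
    rewrite big_pred0 => [|j]; last by have := ltn_ord j; lia.
    by rewrite !open_gapS0; lia.
  have aE : n - a = k.
    have [b2|b2] := leqP n a; first by lia.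
    by have := mx n; rewrite /gap_dist a0F eqxx /=; lia.
  have n0 : n - 1 < n by lia.
  rewrite (eq_bigl (mem (pred1 (Ordinal n0)))) => [|j]; last first.
    by rewrite !inE -val_eqE /=; have := ltn_ord j; lia.
  rewrite sum_nat_const card1 aE open_gapSk ?wodd //.
  by move: nsp; rewrite eqxx; lia.
have dE i : gap_dist n a b i = minn (i - a) (b - i) by rewrite /gap_dist a0F (negbTE bn1).
rewrite /gapS /gsize a0F (negbTE bn1).
have gk : b - a - 1 <= 2 * k.
  have [?|?] := leqP b a.+1; first by lia.
  have : minn (a + (b - a)./2 - a) (b - (a + (b - a)./2)) <= k.
    by rewrite -dE mx //; lia.
  lia.
have [g1|g1] := ltnP (b - a - 1) (2 * k - 1).
  rewrite big_pred0 => [|j]; last by rewrite dE; lia.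
  by rewrite !multS_gt; lia.
have [g2|g2] := eqVneq (b - a - 1) (2 * k - 1).
  have jn : a + k - 1 < n by lia.
  rewrite (eq_bigl (mem (pred1 (Ordinal jn)))) => [|j]; last first.
    by rewrite !inE -val_eqE /= dE; clear -ab g2 k0; lia.
  rewrite sum_nat_const card1 g2 wodd multS_gt; last by lia.
  by rewrite multS_split ?eqxx ?multS_gt ?uphalfE; lia.
have {g1 g2 gk} gk : b - a - 1 = 2 * k by lia.
have j1n : a + k - 1 < n by lia.
have j2n : a + k < n by lia.
rewrite (eq_bigl (mem (pred2 (Ordinal j1n) (Ordinal j2n)))) => [|j]; last first.
  by rewrite !inE -!val_eqE /= dE; clear -ab gk k0; lia.
rewrite sum_nat_const card2 gk -val_eqE /=.
have -> : (a + k - 1 != a + k) by lia.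
(* For k = 1 two positions of weight 2 match the two elements of S(2) = {2, 1}. *)
have [k1|k1] := eqVneq k 1.
  have S11 : multS 1 1 = 1 by rewrite multS_split // !multS_gt.
  by rewrite k1 !(@multS_split 2) // S11 !multS_gt.
rewrite /weight ifT; last by lia.
rewrite [multS (2 * k) (2 * k)]multS_split ?eqxx; last by lia.
rewrite [multS (2 * k) (2 * k - 1)]multS_split; last by lia.
rewrite !multS_gt ?uphalfE; try lia.
Qed.

(** * The gaps of an occupied set *)

Section Gaps.
Variable n : nat.
Implicit Types (O : {set 'I_n}) (j : 'I_n).

(** The virtual positions 0 and n + 1 count as occupied, so that open ends are gaps as well;
    payphone [j] has position [j.+1]. *)
Definition occ O (x : nat) :=
  [|| x == 0, x == n.+1 | [exists i in O, i.+1 == x]].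

(** Neighbouring occupied positions form an empty gap, which contributes nothing. *)
Definition gap O (a b : nat) :=
  [&& a < b, occ O a, occ O b & [forall x : 'I_n.+2, occ O x ==> ~~ (a < x < b)]].

Lemma occ_ord O j : occ O j.+1 = (j \in O).
Proof.
rewrite /occ /= eqSS (ltn_eqF (ltn_ord j)) /=.
apply/existsP/idP => [[i /andP[iO]]|jO]; last by exists j; rewrite jO /=.
by rewrite eqSS => /eqP /val_inj <-.
Qed.

Lemma occ_add O j x : occ (j |: O) x = (x == j.+1) || occ O x.
Proof.
rewrite /occ; have -> : [exists i in j |: O, i.+1 == x] =
    (x == j.+1) || [exists i in O, i.+1 == x]; last by do 3 case: (_ == _).
apply/existsP/idP => [[i /andP[]]|/orP[/eqP ->|/existsP[i /andP[iO xi]]]].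
- rewrite !inE => /orP[/eqP -> /eqP <-|iO xi]; first by rewrite eqxx.
  by apply/orP; right; apply/existsP; exists i; rewrite iO.
- by exists j; rewrite !inE !eqxx.
- by exists i; rewrite !inE iO orbT.
Qed.

Lemma occ_le O x : occ O x -> x <= n.+1.
Proof.
case/or3P => [/eqP -> //|/eqP -> //|/existsP[i /andP[_ /eqP <-]]].
exact: leqW (ltn_ord i).
Qed.

Lemma gapP O a b :
  reflect ([/\ a < b, occ O a, occ O b & forall x, occ O x -> ~~ (a < x < b)])
    (gap O a b).
Proof.
apply: (iffP and4P) => -[ab oa ob h]; split=> //.
  move=> x ox; have xn : x < n.+2 by rewrite ltnS (occ_le ox).
  by move/forallP: h => /(_ (Ordinal xn)); rewrite /= ox.
by apply/forallP => x; apply/implyP => ?; apply: h.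
Qed.

Lemma gap_ends O a b : O != set0 -> gap O a b -> ~~ ((a == 0) && (b == n.+1)).
Proof.
case/set0Pn=> i iO /gapP[_ _ _ /(_ i.+1)]; rewrite occ_ord iO => /(_ isT).
by have := ltn_ord i; lia.
Qed.

Lemma gap_le O a b : gap O a b -> b <= n.+1.
Proof. by case/gapP => _ _ /occ_le. Qed.

Lemma gap_avail O a b j : gap O a b -> a < j.+1 < b -> j \notin O.
Proof. by move=> /gapP[_ _ _ h] jab; rewrite -occ_ord; apply/negP=> /h; rewrite jab. Qed.

Lemma gap_exists O j : j \notin O ->
  exists p : 'I_n.+2 * 'I_n.+2, gap O p.1 p.2 && (p.1 < j.+1 < p.2).
Proof.
move=> jO; have jn := ltn_ord j.
have e0 : exists x, occ O x && (x < j.+1) by exists 0.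
have b0 x : occ O x && (x < j.+1) -> x <= n.+1 by case/andP=> /occ_le.
have e1 : exists x, occ O x && (j.+1 < x).
  by exists n.+1; rewrite /occ eqxx orbT /=; lia.
case: (ex_maxnP e0 b0) => a /andP[oa aj] amax.
case: (ex_minnP e1) => b /andP[ob bj] bmin.
have an : a < n.+2 by lia.
have bn : b < n.+2 by have := occ_le ob; lia.
exists (Ordinal an, Ordinal bn) => /=; rewrite aj bj !andbT.
apply/gapP; split=> // [|x ox]; first by lia.
have xj : x != j.+1 by apply: contraNneq jO => xj; rewrite -occ_ord -xj.
have := amax x; have := bmin x; rewrite ox /=; lia.
Qed.

Lemma gap_uniq O a b c d x : gap O a b -> gap O c d -> a < x < b -> c < x < d ->
  (a == c) && (b == d).
Proof.
move=> /gapP[_ oa ob h1] /gapP[_ oc od h2] xab xcd.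
have := h1 _ oc; have := h1 _ od; have := h2 _ oa; have := h2 _ ob; lia.
Qed.

Lemma gap_add O j a b c d : gap O a b -> a < j.+1 < b ->
  gap (j |: O) c d = [|| gap O c d && ~~ ((c == a) && (d == b)),
    (c == a) && (d == j.+1) | (c == j.+1) && (d == b)].
Proof.
move=> /gapP[ab oa ob h] jab; apply/gapP/idP.
- case=> cd; rewrite !occ_add => oc od h'.
  have ha := h' a; have hb := h' b; have hj := h' j.+1; rewrite !occ_add in ha hb hj.
  rewrite oa ob orbT eqxx /= in ha hb hj.
  case/orP: oc => [/eqP cj|oc].
    have dj : d == j.+1 = false by lia.
    rewrite dj /= in od; have := h _ od; lia.
  case/orP: od => [/eqP dj|od].
    have := h _ oc; lia.
  have -> /= : gap O c d.
    by apply/gapP; split=> // x ox; apply: h'; rewrite occ_add ox orbT.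
  lia.
- case/or3P => [/andP[/gapP[cd oc od h']]|/andP[/eqP -> /eqP ->]|/andP[/eqP -> /eqP ->]].
  + move=> ncd; split=> //; rewrite ?occ_add ?oc ?od ?orbT //.
    move=> x; rewrite occ_add => /orP[/eqP ->|]; last exact: h'.
    have := h _ oc; have := h _ od; have := h' _ oa; have := h' _ ob; lia.
  + split; rewrite ?occ_add ?oa ?eqxx ?orbT //; first by lia.
    by move=> x; rewrite occ_add => /orP[/eqP ->|/h]; lia.
  + split; rewrite ?occ_add ?ob ?eqxx ?orbT //; first by lia.
    by move=> x; rewrite occ_add => /orP[/eqP ->|/h]; lia.
Qed.

Definition gapsS O x := \sum_(p : 'I_n.+2 * 'I_n.+2 | gap O p.1 p.2) gapS n p.1 p.2 x.

(** The gap that disappears is added on the left instead of subtracted on the right, as subtraction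
    on [nat] truncates. *)
Lemma gapsS_add O j a b x : gap O a b -> a < j.+1 < b ->
  gapsS (j |: O) x + gapS n a b x = gapsS O x + (gapS n a j.+1 x + gapS n j.+1 b x).
Proof.
move=> gab jab; have bn := gap_le gab.
have an2 : a < n.+2 by lia.
have bn2 : b < n.+2 by lia.
have jn2 : j.+1 < n.+2 by lia.
pose A := Ordinal an2; pose B := Ordinal bn2; pose J := Ordinal jn2.
rewrite /gapsS (bigD1 (A, J)) /=; last by rewrite (gap_add _ _ gab) //= !eqxx orbT.
rewrite (bigD1 (J, B)) /=; last first.
  rewrite (gap_add _ _ gab) //= !eqxx !orbT /=.
  by apply/eqP => -[]; lia.
rewrite [in RHS](bigD1 (A, B)) //=.
rewrite (eq_bigl (fun p : 'I_n.+2 * 'I_n.+2 => gap O p.1 p.2 && (p != (A, B)))).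
  ring.
move=> [c d]; rewrite !xpair_eqE /= (gap_add _ _ gab) // -!val_eqE /=.
case gcd: (gap O c d) => /=; last by lia.
have jO := gap_avail gab jab; case/gapP: gcd => _ oc od _.
have -> : (c == j.+1 :> nat) = false by apply: contraNF jO => /eqP e; rewrite -occ_ord -e.
have -> : (d == j.+1 :> nat) = false by apply: contraNF jO => /eqP e; rewrite -occ_ord -e.
by lia.
Qed.

Lemma leq_closest_dist O j d :
  (d <= closest_dist O j) = (d <= n) && [forall i in O, d <= `|i - j|%N].
Proof.
have seqE s : (d <= \big[minn/n]_(i <- s | i \in O) `|i - j|%N) =
    (d <= n) && all (fun i : 'I_n => (i \in O) ==> (d <= `|i - j|%N)) s.
  elim: s => [|i s IH]; first by rewrite big_nil andbT.
  by rewrite big_cons /=; case: (i \in O) => //=; rewrite leq_min IH andbCA.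
rewrite /closest_dist seqE; congr (_ && _).
apply/allP/forallP => h i; first by apply: h; rewrite mem_index_enum.
by move=> _; apply: h.
Qed.

(** All occupied payphones lie on or beyond the boundaries of the gap, and a boundary other than 0
    and n + 1 is itself occupied; as [O] is nonempty, at least one boundary is of this kind. *)
Lemma closest_distE O j a b : O != set0 -> gap O a b -> a < j.+1 < b ->
  closest_dist O j = gap_dist n a b j.+1.
Proof.
move=> O0 gab jab; have nends := gap_ends O0 gab; have bn := gap_le gab.
have cd_le i : i \in O -> closest_dist O j <= `|i - j|%N.
  move: (leqnn (closest_dist O j)); rewrite leq_closest_dist.
  by case/andP => _ /forallP /(_ i) /implyP.
case/gapP: (gab) => ab oa ob h.
apply/eqP; rewrite eqn_leq; apply/andP; split; last first.
  rewrite leq_closest_dist; apply/andP; split.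
    by rewrite /gap_dist; have := ltn_ord j; case: eqP; case: eqP; lia.
  apply/forall_inP => i iO.
  have := h i.+1; rewrite occ_ord iO => /(_ isT).
  rewrite /gap_dist; have := ltn_ord j; have := ltn_ord i; move: nends.
  by case: eqP; case: eqP; lia.
have la : a != 0 -> closest_dist O j <= j.+1 - a.
  move=> a0; have an : a.-1 < n by lia.
  have := cd_le (Ordinal an); rewrite -occ_ord /=.
  by rewrite prednK ?oa; lia.
have lb : b != n.+1 -> closest_dist O j <= b - j.+1.
  move=> a0; have an : b.-1 < n by lia.
  have := cd_le (Ordinal an); rewrite -occ_ord /=.
  by rewrite prednK ?ob; lia.
rewrite /gap_dist leq_min; have [a0|a0] := eqVneq a 0; have [b0|b0] := eqVneq b n.+1.
- by move: nends; rewrite a0 b0 !eqxx.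
- by rewrite lb // andbT (leq_trans (lb b0)) //; lia.
- by rewrite la //= (leq_trans (la a0)) //; have := ltn_ord j; lia.
- by rewrite la // lb.
Qed.

End Gaps.

(** * Completions summed over the farthest payphones *)

Section Completions.
Variable n : nat.
Implicit Types (O : {set 'I_n}) (j : 'I_n).

(* The number of ways to complete the assignment from the occupied set O. The
   factor 2 is the order of two open ends of length 1, possible only when n = 3
   in actual runs. *)
Definition completions O :=
  (if gap O 0 2 && gap O (n - 1) n.+1 then 2 else 1) * Gfun (2 * n) (gapsS O).

Lemma completions_gt0 O : 0 < completions O.
Proof. by rewrite muln_gt0 Gfun_gt0; case: ifP. Qed.

(** Taking [j] removes one element [gsize n a b] from the multiset, so [Gfun_step] applies; the
    weight turns the factor [ways] into 2, which makes the factor on the right the same for all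
    [j]. *)
Lemma completions_far O j a b k : O != set0 -> 1 < n ->
  (forall i : 'I_n, i \notin O -> closest_dist O i <= k) ->
  ~~ ((k == 1) && (gap O 0 2 || gap O (n - 1) n.+1)) ->
  0 < k -> gap O a b -> a < j.+1 < b -> gap_dist n a b j.+1 = k ->
  weight (gsize n a b) * completions O =
  2 * (gapsS O (2 * k) + gapsS O (2 * k - 1)) * completions (j |: O).
Proof.
move=> O0 n1 far nsp k0 gab jab jk; have jn := ltn_ord j.
have nab := gap_ends O0 gab; have bn := gap_le gab.
have mx i : a < i < b -> gap_dist n a b i <= k.
  case: i => // i iab; have lin : i < n by lia.
  rewrite -(@closest_distE _ O (Ordinal lin)) //; apply: far.
  exact: gap_avail gab _.
have sl : (a == 0) && (b == 2) = false.
  apply/negP => /andP[/eqP a0 /eqP b2]; subst a b; move: nsp jk.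
  by rewrite gab andbT /gap_dist /= ifF; lia.
have sr : (a == n - 1) && (b == n.+1) = false.
  apply/negP => /andP[/eqP a0 /eqP b2]; subst a b; move: nsp jk.
  by rewrite gab orbT andbT /gap_dist /= ifF ?eqxx; lia.
(* The choice neither fills nor creates an open end of length 1: the former is excluded by [sl] and
   [sr], and in a longer open end the end of the row is farther than its neighbour. *)
have -> : completions (j |: O) =
  (if gap O 0 2 && gap O (n - 1) n.+1 then 2 else 1) * Gfun (2 * n) (gapsS (j |: O)).
  rewrite /completions !(gap_add _ _ gab) //.
  have -> : (0 == a) && (2 == b) = false by lia.
  have -> : (n - 1 == a) && (n.+1 == b) = false by lia.
  have -> : (0 == a) && (2 == j.+1) = false.
    apply/negP => /andP[/eqP a0 /eqP j2]; subst a; move: (mx 1) nab; rewrite -jk /gap_dist /=.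
    by case: (b == n.+1) => //=; lia.
  have -> : (n - 1 == j.+1) && (n.+1 == b) = false.
    apply/negP => /andP[/eqP a0 /eqP j2]; subst b; move: (mx n) nab; rewrite -jk /gap_dist eqxx.
    by case: (a == 0) => //=; lia.
  have -> : (n.+1 == j.+1) = false by lia.
  by rewrite /= !andbF !orbF !andbT.
rewrite /completions (@Gfun_step (2 * n) (gapsS O) (gapsS (j |: O)) (gsize n a b) k).
- set F := if _ then _ else _; set c := _ + _; set G' := Gfun _ _.
  by rewrite -(weight_ways (gsize n a b)); ring.
- rewrite k0 -jk /gap_dist; case: eqP => _; case: eqP; lia.
- exact: gsize_class jab bn nab jk mx.
- move=> x; have := gapsS_add x gab jab.
  rewrite (gapS_split x jab bn nab sl sr jk mx); lia.
Qed.

(** After multiplication by [2 * c], with [c] the size of the class, each term becomes a weight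
    times [completions O]; grouped by gap, the weights add up to [2 * c] by [gap_choices]. *)
Lemma sum_far O k : O != set0 -> 1 < n ->
  (forall i : 'I_n, i \notin O -> closest_dist O i <= k) ->
  (exists2 i : 'I_n, i \notin O & closest_dist O i = k) ->
  ~~ ((k == 1) && (gap O 0 2 || gap O (n - 1) n.+1)) -> 0 < k ->
  \sum_(j | (j \notin O) && (closest_dist O j == k)) completions (j |: O) =
  completions O.
Proof.
move=> O0 n1 far ex nsp k0; set c := gapsS O (2 * k) + gapsS O (2 * k - 1).
have step := fun j a b => @completions_far O j a b k O0 n1 far nsp k0.
(* At the witness the left side of [step] is positive, hence so is [c]. *)
have c0 : 0 < c.
  case: ex => i iO ik; have [p /andP[gp ip]] := gap_exists iO.
  have := step i p.1 p.2 gp ip; rewrite -(closest_distE O0 gp ip) => /(_ ik).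
  have := completions_gt0 O; rewrite /weight -/c.
  by case: ifP => _; case: (c) => //; lia.
apply/eqP; rewrite -(@eqn_pmul2l (2 * c)); last by rewrite muln_gt0.
rewrite big_distrr /=; apply/eqP.
pose inside (p : 'I_n.+2 * 'I_n.+2) j := p.1 < j.+1 < p.2.
(* The inner sum has a single term, the unique gap containing [j]; it is there to exchange the
   sums. *)
transitivity (\sum_(j | (j \notin O) && (closest_dist O j == k))
    \sum_(p : 'I_n.+2 * 'I_n.+2 | gap O p.1 p.2 && inside p j)
       weight (gsize n p.1 p.2) * completions O).
  apply: eq_bigr => j /andP[jO /eqP jk]; have [p /andP[gp jp]] := gap_exists jO.
  rewrite (big_pred1 p) => [|q].
    by rewrite (step j p.1 p.2 gp jp) // -(closest_distE O0 gp jp).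
  apply/andP/eqP => [[gq jq]|->]; last by [].
  have := gap_uniq gp gq jp jq; case: (p) (q) => [p1 p2] [q1 q2] /=.
  by case/andP => /eqP/val_inj -> /eqP/val_inj ->.
rewrite (exchange_big_dep (fun p : 'I_n.+2 * 'I_n.+2 => gap O p.1 p.2)) /=; last first.
  by move=> j p _ /andP[].
transitivity (\sum_(p : 'I_n.+2 * 'I_n.+2 | gap O p.1 p.2)
    2 * (gapS n p.1 p.2 (2 * k) + gapS n p.1 p.2 (2 * k - 1)) * completions O); last first.
  by rewrite -big_distrl -big_distrr /= big_split.
apply: eq_bigr => p gp; rewrite -gap_choices ?gap_le //.
- rewrite big_distrl /=; apply: eq_bigl => j; rewrite gp /= /inside.
  case jp: (p.1 < j.+1 < p.2); last by rewrite andbF.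
  by rewrite (gap_avail gp jp) /= andbT (closest_distE O0 gp jp).
- by case/gapP: gp.
- exact: gap_le gp.
- exact: gap_ends gp.
- case=> // i ip; have ilt : i < n by have := gap_le gp; lia.
  rewrite -(@closest_distE _ O (Ordinal ilt) _ _ O0 gp ip); apply: far.
  by apply: (gap_avail gp).
- apply/implyP => k1; rewrite k1 /= negb_or in nsp.
  case/andP: nsp => nl nr; apply/andP; split.
    by apply: contraNN nl => /andP[/eqP pa /eqP pb]; move: gp; rewrite pa pb.
  by apply: contraNN nr => /andP[/eqP pa /eqP pb]; move: gp; rewrite pa pb.
Qed.

End Completions.

(** * Open ends of length 1 and the recurrence under rule (P3) *)

Section Recurrence.
Variable n : nat.
Implicit Types (O : {set 'I_n}) (j : 'I_n).

Lemma gapS_succ a x : gapS n a a.+1 x = 0.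
Proof.
rewrite /gapS /open_gapS; case: posnP => [->|a0]; first by rewrite mset0E.
case: eqP => [[->]|_]; first by rewrite subnn mset0E.
by rewrite subSnn subnn mset0E.
Qed.

(** An open end of length 1 contributes the empty multiset, so filling it keeps [gapsS]; only the
    factor for two such ends is lost. *)
Lemma completions_left_end O j : O != set0 -> j = 0 :> nat -> gap O 0 2 ->
  completions (j |: O) = Gfun (2 * n) (gapsS O).
Proof.
move=> O0 j0 g; have n1 : (2 == n.+1) = false by have := gap_ends O0 g; lia.
have jin : 0 < j.+1 < 2 by rewrite j0.
rewrite /completions (gap_add 0 2 g) // j0 !andbF /= mul1n.
apply: eq_Gfun => x; have := gapsS_add x g jin; rewrite j0 !gapS_succ.
by rewrite {1}/gapS /open_gapS /= !addn0.
Qed.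

Lemma completions_right_end O j : O != set0 -> j = n - 1 :> nat ->
  gap O (n - 1) n.+1 -> completions (j |: O) = Gfun (2 * n) (gapsS O).
Proof.
move=> O0 jn g; have nends := gap_ends O0 g.
have jE : j.+1 = n by have := ltn_ord j; lia.
have n0 : (n - 1 == 0) = false by move: nends; rewrite eqxx andbT; case: eqP.
have jin : n - 1 < j.+1 < n.+1 by lia.
rewrite /completions !(gap_add _ _ g) // jE !eqxx /=.
have -> : (n - 1 == n) = false by lia.
have -> : (n.+1 == n) = false by lia.
rewrite /= !andbF /= mul1n.
apply: eq_Gfun => x; have := gapsS_add x g jin; rewrite jE gapS_succ.
have -> : gapS n (n - 1) n x = 0 by rewrite -[RHS](gapS_succ (n - 1) x); congr gapS; lia.
by rewrite {1}/gapS n0 eqxx /open_gapS (_ : n - (n - 1) == 1) ?addn0; lia.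
Qed.

(** The distance offered by payphone 1 is the length of the left open end. *)
Lemma near_left_end O j : O != set0 -> 1 < n -> j = 0 :> nat -> j \notin O ->
  closest_dist O j <= 1 -> gap O 0 2.
Proof.
move=> O0 n1 j0 jO; have [[a b] /= /andP[g jin]] := gap_exists jO.
have nends := gap_ends O0 g; have jn := ltn_ord j.
rewrite (@closest_distE n O j a b O0 g jin) /gap_dist /= j0.
have a0 : a = 0 :> nat by lia.
move: nends; rewrite a0 /= => /negbTE -> /= h.
have b2 : b = 2 :> nat by lia.
by rewrite a0 b2 in g.
Qed.

Lemma near_right_end O j : O != set0 -> 1 < n -> j = n - 1 :> nat -> j \notin O ->
  closest_dist O j <= 1 -> gap O (n - 1) n.+1.
Proof.
move=> O0 n1 jE jO; have [[a b] /= /andP[g jin]] := gap_exists jO.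
have nends := gap_ends O0 g; have bn := ltn_ord b; have jn := ltn_ord j.
rewrite (@closest_distE n O j a b O0 g jin) /gap_dist /=.
have b0 : b = n.+1 :> nat by lia.
move: nends; rewrite b0 eqxx andbT => /negbTE -> /= h.
have a1 : a = n - 1 :> nat by lia.
by rewrite a1 b0 in g.
Qed.

(** Every available end contributes the same number, and two available ends produce the factor 2 in
    [completions]. *)
Lemma sum_ends O : O != set0 -> 1 < n ->
  (forall i : 'I_n, i \notin O -> closest_dist O i <= 1) ->
  gap O 0 2 || gap O (n - 1) n.+1 ->
  \sum_(j | (j \notin O) && open_end j) completions (j |: O) = completions O.
Proof.
move=> O0 n1 near sp.
have n0 : 0 < n by lia.
have nn : n - 1 < n by lia.
pose jl := Ordinal n0; pose jr := Ordinal nn.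
have lr : jl != jr by rewrite -val_eqE /=; lia.
have lE : (jl \notin O) = gap O 0 2.
  apply/idP/idP => [jO|g]; last exact: gap_avail g _.
  exact: (@near_left_end O jl O0 n1 _ jO (near _ jO)).
have rE : (jr \notin O) = gap O (n - 1) n.+1.
  apply/idP/idP => [jO|g]; last by apply: gap_avail g _ => /=; lia.
  exact: (@near_right_end O jr O0 n1 _ jO (near _ jO)).
have chE j : (j \notin O) && open_end j =
    (j == jl) && gap O 0 2 || (j == jr) && gap O (n - 1) n.+1.
  rewrite -lE -rE /open_end andbC -[_ == 0]/(j == jl) -[_ == n - 1]/(j == jr).
  have [->|_] := eqVneq j jl; first by rewrite (negbTE lr) /= orbF.
  by have [->|_] := eqVneq j jr.
rewrite (eq_bigl _ _ chE).
rewrite (eq_bigr (fun=> Gfun (2 * n) (gapsS O))) => [|j]; last first.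
  case/orP=> /andP[/eqP ->].
    exact: completions_left_end.
  exact: completions_right_end.
rewrite /completions; move: sp; case: (gap O 0 2); case: (gap O (n - 1) n.+1) => //= _.
- rewrite (eq_bigl (mem (pred2 jl jr))) => [|j]; last by rewrite !inE !andbT.
  by rewrite sum_nat_const card2 lr.
- by rewrite (big_pred1 jl) ?mul1n // => j; rewrite andbT andbF orbF.
- by rewrite (big_pred1 jr) ?mul1n // => j; rewrite andbT andbF.
Qed.

Lemma exists_far O k : 1 < n ->
  (forall i : 'I_n, i \notin O -> closest_dist O i <= k) ->
  (exists2 i : 'I_n, i \notin O & closest_dist O i = k) ->
  [exists i, available O i && [forall o in O, 2 <= `|i - o|%N]] = (1 < k).
Proof.
move=> n1 far [i0 i0O i0k].
have farE (i : 'I_n) : [forall o in O, 2 <= `|i - o|%N] = (1 < closest_dist O i).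
  rewrite leq_closest_dist n1; apply: eq_forallb => o; by rewrite distnC.
apply/existsP/idP => [[i /andP[iO]]|k1].
  by rewrite farE => /leq_trans; apply; apply: far.
by exists i0; rewrite farE i0k k1 andbT.
Qed.

Lemma P3_choice_far O j k : O != set0 -> 1 < n -> 0 < k ->
  (forall i : 'I_n, i \notin O -> closest_dist O i <= k) ->
  (exists2 i : 'I_n, i \notin O & closest_dist O i = k) ->
  ~~ ((k == 1) && (gap O 0 2 || gap O (n - 1) n.+1)) ->
  P3_choice O j = (j \notin O) && (closest_dist O j == k).
Proof.
move=> O0 n1 k0 far ex nsp; rewrite /P3_choice (exists_far n1 far ex).
case: ex => i0 i0O i0k.
have [k1|k1] := ltnP 1 k.
  rewrite /P1_choice /available; case jO: (j \notin O) => //=.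
  apply/forallP/eqP => [h|-> i]; last by apply/implyP/far.
  apply/eqP; rewrite eqn_leq far ?jO //=.
  by have := h i0; rewrite i0O i0k.
have {k1} kE : k = 1 by lia.
(* Without an open end of length 1, an available end payphone would be at distance at least 2; so
   none is available, and all available payphones, being at distance 1, are allowed. *)
rewrite kE in far i0k nsp *; rewrite ifF; last first.
  apply/existsP => -[i /andP[iO /orP ie]].
  move: nsp; rewrite eqxx /= negb_or => /andP[/negP nl /negP nr].
  case: ie => /eqP ie.
    by apply: nl; apply: near_left_end (far _ iO).
  by apply: nr; apply: near_right_end (far _ iO).
rewrite /available; case jO: (j \notin O) => //=; symmetry; apply/eqP/eqP.
rewrite eqn_leq far ?jO //= leq_closest_dist (ltnW n1) /=.
apply/forall_inP => i iO; rewrite lt0n distn_eq0.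
by apply: contraNN jO => /eqP /val_inj <-.
Qed.

(** With [k] the greatest distance on offer, [sum_ends] settles the case where rule (P3) forces an
    end, and [sum_far] all others. *)
Lemma completions_rec O : O != set0 -> O != setT ->
  completions O = \sum_(j | (j \notin O) && P3_choice O j) completions (j |: O).
Proof.
move=> O0 OT.
have /set0Pn[i iO] := O0.
have [j jO] : exists j, j \notin O.
  by apply/existsP; apply: contraNT OT; rewrite negb_exists => /forallP h;
     apply/eqP/setP => x; rewrite inE; have := h x; rewrite negbK.
have ij : i != j by apply: contraNneq jO => <-.
have n1 : 1 < n.
  by move: ij; rewrite -val_eqE /=; have := ltn_ord i; have := ltn_ord j; lia.
pose k := \max_(i | i \notin O) closest_dist O i.
have far (x : 'I_n) : x \notin O -> closest_dist O x <= k.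
  by move=> xO; apply: (@leq_bigmax_cond _ (fun i => i \notin O) (closest_dist O)).
have ex : exists2 x : 'I_n, x \notin O & closest_dist O x = k.
  have c0 : 0 < #|[pred x | x \notin O]| by apply/card_gt0P; exists j.
  by have [x xO xk] := eq_bigmax_cond (closest_dist O) c0; exists x.
have k0 : 0 < k.
  apply: leq_trans (far _ jO); rewrite leq_closest_dist (ltnW n1) /=.
  apply/forall_inP => x xO; rewrite lt0n distn_eq0.
  by apply: contraNN jO => /eqP /val_inj <-.
have [/andP[/eqP k1 sp]|nsp] := boolP ((k == 1) && (gap O 0 2 || gap O (n - 1) n.+1)).
  rewrite -sum_ends // -?k1 //; apply: eq_bigl => x.
  rewrite /P3_choice (exists_far n1 far ex) k1 /= ifT.
    by rewrite /available andbA andbb.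
  apply/existsP; case/orP: sp => g.
    have n0 : 0 < n by lia.
    by exists (Ordinal n0); rewrite /open_end eqxx andbT; apply: gap_avail g _.
  have n0 : n - 1 < n by lia.
  exists (Ordinal n0); rewrite /open_end eqxx orbT andbT.
  by apply: gap_avail g _ => /=; lia.
rewrite -(sum_far O0 n1 far ex nsp k0); apply: eq_bigl => x.
by rewrite (P3_choice_far x O0 n1 k0 far ex nsp) andbA andbb.
Qed.

End Recurrence.

(** * The first person and the final formula *)

Lemma gap_set0 n a b : gap (set0 : {set 'I_n}) a b = (a == 0) && (b == n.+1).
Proof.
have occ0 x : occ (set0 : {set 'I_n}) x = (x == 0) || (x == n.+1).
  rewrite /occ orbA; case: existsP => [[i]|]; last by rewrite orbF.
  by rewrite inE.
apply/gapP/idP; rewrite !occ0; first by case; lia.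
by move=> ab; split; try lia; move=> x; rewrite occ0; lia.
Qed.

Lemma gap_set1 n (i : 'I_n) a b :
  gap [set i] a b = (a == 0) && (b == i.+1) || (a == i.+1) && (b == n.+1).
Proof.
have g0 : gap (set0 : {set 'I_n}) 0 n.+1 by rewrite gap_set0 !eqxx.
rewrite -[[set i]]setU0 (gap_add _ _ g0) /= ?ltnS ?ltn_ord // gap_set0.
by rewrite andbN.
Qed.

(** Here [i] counts payphones from 0. Both open ends have length 1 only around the middle payphone
    of three. *)
Definition completions1 n i :=
  (if (n == 3) && (i == 1) then 2 else 1) *
  Gfun (2 * n) (fun x => gapS n 0 i.+1 x + gapS n i.+1 n.+1 x).

Lemma completions_set1 n (i : 'I_n) : completions [set i] = completions1 n i.
Proof.
have ilt := ltn_ord i.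
rewrite /completions /completions1 !gap_set1; congr (_ * _).
  congr (if _ then _ else _); lia.
apply: eq_Gfun => x.
have g0 : gap (set0 : {set 'I_n}) 0 n.+1 by rewrite gap_set0 !eqxx.
have := @gapsS_add n set0 i _ _ x g0; rewrite setU0 /= ltnS ilt => /(_ isT).
(* The empty set has the whole row as its only gap, whose term cancels in [gapsS_add]. *)
have -> : gapsS (set0 : {set 'I_n}) x = gapS n 0 n.+1 x.
  rewrite /gapsS (big_pred1 (ord0, ord_max)) // => -[a b].
  by rewrite /= gap_set0 xpair_eqE -!val_eqE.
lia.
Qed.

Lemma completions_setT n : 0 < n -> completions [set: 'I_n] = 1.
Proof.
move=> n0.
have gapT a b : gap [set: 'I_n] a b -> b = a.+1.
  move=> g; case/gapP: (g) => ab _ _ h.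
  have [alt|] := ltnP a n; last by have := gap_le g; lia.
  by have := h (Ordinal alt).+1; rewrite occ_ord inE => /(_ isT) /=; lia.
rewrite /completions ifF; last by apply/negP => /andP[/gapT].
rewrite mul1n -[RHS](Gfun0 (2 * n)); apply: eq_Gfun => x.
by rewrite /gapsS big1 // => p /gapT ->; rewrite gapS_succ.
Qed.

Lemma P3_sum n : 0 < n -> P3 n = \sum_(0 <= i < n) completions1 n i.
Proof.
move=> n0.
(* The recurrence for [completions] needs a nonempty set; at the empty set the value encodes the
   free choice of the first person. *)
pose W (O : {set 'I_n}) :=
  if O == set0 then \sum_(i < n) completions [set i] else completions O.
have T0 : [set: 'I_n] != set0.
  by apply/set0Pn; exists (Ordinal n0); rewrite inE.
rewrite big_mkord; transitivity (W set0); last first.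
  by rewrite /W eqxx; apply: eq_bigr => i _; rewrite completions_set1.
apply: (card_greedy_perms (ch := fun O => allowed_choice O)) => [|O OT].
  by rewrite /W (negbTE T0) completions_setT.
rewrite /W; have [->|O0] := eqVneq O set0.
  apply: eq_big => [i|i _]; first by rewrite inE /allowed_choice eqxx.
  rewrite setU0 ifF //; apply/negbTE/set0Pn; exists i; exact: set11.
rewrite completions_rec //; apply: eq_big => [i|i _].
  by rewrite /allowed_choice (negbTE O0).
rewrite ifF //; apply/negbTE/set0Pn; exists i; exact: setU11.
Qed.

(** The payphones next to the ends of the row leave an open end of length 1, replaced by the empty
    multiset. *)
Lemma completions1E n i : 0 < i < n - 1 -> n != 3 -> 
  completions1 n i = G ((if i == 1 then mset0 else multS' i) `+`
    (if i == n - 2 then mset0 else multS' (n - i.+1))).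
Proof.
move=> iin n3; rewrite /completions1 (negbTE n3) mul1n.
rewrite (@GfunE (2 * n)) => [|x xn].
  apply: eq_Gfun => x; rewrite /gapS /= eqxx /open_gapS subn1 /= msetE2.
  have -> : (n - i.+1 == 1) = (i == n - 2) by lia.
  by congr (_ + _); case: ifP => //; rewrite mset0E.
rewrite msetE2; case: ifP => _; case: ifP => _.
all: rewrite ?mset0E ?multS'_gt //; lia.
Qed.

Lemma completions1_left n : 2 < n -> completions1 n 0 = G (multS' (n - 1)).
Proof.
move=> n2; rewrite /completions1 andbF mul1n (@GfunE (2 * n)) => [|x xn].
  apply: eq_Gfun => x; rewrite gapS_succ /gapS /= eqxx /open_gapS ifF //; lia.
by rewrite multS'_gt //; lia.
Qed.

Lemma completions1_right n : 2 < n -> completions1 n (n - 1) = G (multS' (n - 1)).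
Proof.
move=> n2; have n3 : (n == 3) && (n - 1 == 1) = false by lia.
rewrite /completions1 n3 mul1n (@GfunE (2 * n)) => [|x xn]; last by rewrite multS'_gt //; lia.
apply: eq_Gfun => x; have -> : (n - 1).+1 = n by lia.
by rewrite gapS_succ addn0 /gapS /= /open_gapS ifF //; lia.
Qed.

Lemma G_multS'_2 : G (multS' 2) = 1.
Proof.
(* S'(2) = {1, 3}, with its elements in different classes. *)
rewrite (@GfunE 3) => [|x]; last by move=> ?; rewrite multS'_gt.
rewrite (@eq_Gfun _ _ (fun x => (x == 1) + (x == 3))) => [|x].
  by rewrite /Gfun unlock.
by rewrite multS'E // multS_split // multS0 mset0E !addn0.
Qed.

Theorem theorem6 :
  [/\ P3 1 = 1, P3 2 = 2, P3 3 = 4 &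
    forall n : nat, 4 <= n ->
      P3 n = 2 * G (multS' (n - 1)) + 2 * G (multS' (n - 2))
             + \sum_(3 <= i < (n - 2).+1)
                 G (multS' (i - 1) `+` multS' (n - i))%mset].
Proof.
split.
- rewrite P3_sum // big_nat1 /completions1 mul1n -[RHS](Gfun0 2).
  by apply: eq_Gfun => x; rewrite !gapS_succ.
- rewrite P3_sum // big_nat_recl // big_nat1 /completions1 !mul1n -[RHS]/(1 + 1).
  by congr (_ + _); rewrite -[RHS](Gfun0 4); apply: eq_Gfun => x; rewrite gapS_succ.
- rewrite P3_sum // !big_nat_recl // big_geq // addn0.
  (* The outer payphones give 1 each, the middle one gives 2 for the order of the two ends. *)
  rewrite completions1_left // (@completions1_right 3) // G_multS'_2 /completions1 /=.
  by rewrite (@eq_Gfun _ _ (fun=> 0)) ?Gfun0.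
move=> n n4; rewrite P3_sum; last by lia.
(* The two payphones at each end of the row are split off; they give the terms with S'(n - 1) and
   S'(n - 2). *)
rewrite (@big_cat_nat _ _ _ 2) //=; last by lia.
rewrite (@big_cat_nat _ _ _ (n - 2) 2 n) //=; try lia.
rewrite [X in X + _]big_ltn // big_nat1.
rewrite [X in _ + (_ + X)]big_ltn; last by lia.
have -> : (n - 2).+1 = n - 1 by lia.
rewrite [X in _ + (_ + (_ + X))]big_ltn; last by lia.
have -> : (n - 1).+1 = n by lia.
rewrite (@big_geq _ _ _ n n) // completions1_left; last by lia.
rewrite completions1_right; last by lia.
have -> : completions1 n 1 = G (multS' (n - 2)).
  rewrite completions1E ?eqxx ?ifF ?mset0D //; lia.
have -> : completions1 n (n - 2) = G (multS' (n - 2)).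
  rewrite completions1E ?eqxx ?ifF ?msetD0 //; lia.
have -> : \sum_(3 <= i < n - 1) G (multS' (i - 1) `+` multS' (n - i)) =
    \sum_(2 <= i < n - 2) completions1 n i.
  (* The formula numbers payphones from 1, [completions1] from 0. *)
  rewrite (_ : n - 1 = (n - 2).+1); last by lia.
  rewrite big_add1 /=; apply: eq_big_nat => i iin.
  rewrite completions1E; try lia.
  by rewrite subn1 /= !ifF //; lia.
lia.
Qed.
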